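(* For every $g\in\mathbb{N}$ there exists a graph $G$ with odd-girth greater than or equal to $g$ that does not have the AOP property.
   Context: All graphs are finite, simple and undirected. The odd-girth of a graph is the number of edges in a shortest odd cycle (a graph without odd cycles is regarded as having infinite odd-girth). An orientation of $G$ assigns exactly one direction to each edge; it is acyclic if it has no directed cycle. A graph $G$ has the AOP (acyclic one path) property if it has an acyclic orientation such that there is at most one directed path between any two vertices, i.e. for all distinct vertices $u,v$ there is at most one directed path from $u$ to $v$. *)

(* Defs.v *)
From mathcomp Require Import all_boot.

Set Implicit Arguments.
Unset Strict Implicit.
Unset Printing Implicit Defensive.

Record sgraph := SGraph {
  vertex :> finType;
  edge : rel vertex;
  edge_sym : symmetric edge;
  edge_irrefl : irreflexive edge }.

(* A cycle is the sequence of its vertices in cyclic order, so that its number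
   of edges is the size of the sequence; [ucycle] alone would admit an edge
   traversed back and forth as a cycle of length 2, and the empty sequence. *)
Definition graph_cycle (G : sgraph) (c : seq G) : Prop :=
  ucycle (@edge G) c /\ 2 < size c.

Definition odd_cycle (G : sgraph) (c : seq G) : Prop :=
  graph_cycle c /\ odd (size c).

Definition has_odd_cycle_of_size (G : sgraph) (n : nat) : bool :=
  [&& 2 < n, odd n & [exists c : n.-tuple G, ucycleb (@edge G) c]].

(* The least length of an odd cycle, with [None] standing for infinity; the
   search may stop at #|G| since cycles do not repeat vertices. *)
Definition odd_girth (G : sgraph) : option nat :=
  ohead [seq n <- iota 0 #|G|.+1 | has_odd_cycle_of_size G n].

(* m <= x in the naturals extended with infinity (represented by [None]) *)
Definition leq_inf (m : nat) (x : option nat) : bool :=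
  if x is Some n then m <= n else true.

Lemma has_odd_cycle_of_sizeP (G : sgraph) (n : nat) :
  reflect (exists2 c : seq G, odd_cycle c & size c = n)
          (has_odd_cycle_of_size G n).
Proof.
apply: (iffP and3P) => [[n2 on /existsP[c uc]] | [c [[uc c2] oc] <-]].
  by exists c; rewrite /odd_cycle /graph_cycle size_tuple.
by split=> //; apply/existsP; exists (in_tuple c).
Qed.

Lemma odd_girth_Some (G : sgraph) (n : nat) :
  odd_girth G = Some n <->
  (exists2 c : seq G, odd_cycle c & size c = n) /\
  (forall c : seq G, odd_cycle c -> n <= size c).
Proof.
rewrite /odd_girth; set s := filter _ _.
have sP k : reflect (exists2 c : seq G, odd_cycle c & size c = k) (k \in s).
  rewrite mem_filter mem_iota leq0n add0n ltnS.
  apply: (iffP andP) => [[/has_odd_cycle_of_sizeP] // | H].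
  split; first exact/has_odd_cycle_of_sizeP.
  case: H => c [[/andP[_ uc] _] _] <-.
  by rewrite -(card_uniqP uc) max_card.
have s_sorted : sorted leq s.
  by apply: sorted_filter; [exact: leq_trans | exact: iota_sorted].
have le_head k x t : s = x :: t -> k \in s -> x <= k.
  move=> Es; move: s_sorted; rewrite Es /= (path_sortedE leq_trans).
  by case/andP=> /allP le_x _; rewrite inE => /predU1P[-> // | /le_x].
case Es: s => [|x t] /=.
  by split=> // -[/sP]; rewrite Es.
split=> [[<-] | [/sP n_s n_min]].
  split=> [|c oc]; first by apply/sP; rewrite Es mem_head.
  by apply: (le_head _ _ _ Es); apply/sP; exists c.
have /sP[c oc sc] : x \in s by rewrite Es mem_head.
congr Some; apply/eqP; rewrite eqn_leq (le_head _ _ _ Es n_s) /=.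
by rewrite -sc n_min.
Qed.

Lemma odd_girth_None (G : sgraph) :
  odd_girth G = None <-> ~ (exists c : seq G, odd_cycle c).
Proof.
split=> [EN [c oc] | noc].
  have ex : exists k, has_odd_cycle_of_size G k.
    by exists (size c); apply/has_odd_cycle_of_sizeP; exists c.
  have [n /has_odd_cycle_of_sizeP n_c n_min] := ex_minnP ex.
  suff : odd_girth G = Some n by rewrite EN.
  apply/odd_girth_Some; split=> // d od.
  by apply: n_min; apply/has_odd_cycle_of_sizeP; exists d.
case E: (odd_girth G) => [n|] //.
by have /odd_girth_Some[[c oc _] _] := E; case: noc; exists c.
Qed.

Definition orientation (G : sgraph) (o : rel G) : Prop :=
  (forall x y, o x y -> edge x y) /\
  (forall x y, edge x y -> o x y (+) o y x).

Definition acyclic (T : eqType) (o : rel T) : Prop :=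
  forall c : seq T, c != [::] -> ~ ucycle o c.

(* [u :: p] is the vertex sequence of a directed path from u to v. *)
Definition dipath (T : eqType) (o : rel T) (u v : T) (p : seq T) : Prop :=
  [/\ path o u p, uniq (u :: p) & last u p = v].

Definition at_most_one_dipath (T : eqType) (o : rel T) : Prop :=
  forall u v : T, u != v ->
  forall p q : seq T, dipath o u v p -> dipath o u v q -> p = q.

Definition AOP (G : sgraph) : Prop :=
  exists o : rel G, [/\ orientation o, acyclic o & at_most_one_dipath o].

(* Main.v *)
Require Import Defs.
From mathcomp Require Import all_boot.

(** Consider the prism over an odd cycle of length [n].  An odd closed walk
    winds around the cycle a nonzero number of times, hence has length at least
    [n].  In an AOP orientation, every 4-cycle alternates between sources and
    sinks; since all edges at a vertex of the prism are linked through
    4-cycles, every vertex would be a source or a sink, so that the prism would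
    be bipartite. *)

Set Implicit Arguments.
Unset Strict Implicit.
Unset Printing Implicit Defensive.

Section AlternatingC4.

Variables (G : sgraph) (o : rel G).
Hypotheses (oG : orientation o) (o_acyclic : acyclic o).
Hypothesis o_unique : at_most_one_dipath o.

Lemma orientation_rev x y : edge x y -> o y x = ~~ o x y.
Proof. by case: oG => _ /[apply]; case: (o x y); case: (o y x). Qed.

(** Each orientation of the other two edges is excluded: [c -> d -> a] closes a directed 4-cycle,
    and the remaining three give two directed paths with the same ends, of lengths 3 and 1 or 2 and
    2. *)
Lemma no_dipath2_in_C4 a b c d :
  uniq [:: a; b; c; d] -> edge c d -> edge d a ->
  o a b -> o b c -> False.
Proof.
move=> Uabcd cd da ab bc.
move: (Uabcd); rewrite /= !inE !negb_or => /and4P[].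
case/and3P=> nab nac nad /andP[nbc nbd] ncd _.
have neq := (negbTE nab, negbTE nac, negbTE nad, negbTE nbc, negbTE nbd,
  negbTE ncd, eq_sym d a, eq_sym d b, eq_sym d c).
have [ocd|ncd'] := boolP (o c d); have [oda|nda] := boolP (o d a).
- apply: (o_acyclic (c := [:: a; b; c; d])) => //.
  by rewrite /ucycle Uabcd /= ab bc ocd oda.
- have oad : o a d by rewrite (orientation_rev da).
  suff: [:: b; c; d] = [:: d] by [].
  by apply: (o_unique nad); split; rewrite //= ?ab ?bc ?ocd ?oad // !inE !neq.
- have odc : o d c by rewrite (orientation_rev cd).
  have ndc : d != c by rewrite eq_sym.
  suff: [:: a; b; c] = [:: c] by [].
  by apply: (o_unique ndc); split; rewrite //= ?ab ?bc ?odc ?oda // !inE !neq.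
- have oad : o a d by rewrite (orientation_rev da).
  have odc : o d c by rewrite (orientation_rev cd).
  suff [bd] : [:: b; c] = [:: d; c] by rewrite bd eqxx in nbd.
  by apply: (o_unique nac); split; rewrite //= ?ab ?bc ?odc ?oad // !inE !neq.
Qed.

(** If the two edges at [a] disagreed, one would enter [a] and the other leave it, giving a directed
    path of length 2 centred at [a]. *)
Lemma alternating_C4 a b c d :
  uniq [:: a; b; c; d] -> edge a b -> edge b c -> edge c d -> edge d a ->
  o a b = o a d.
Proof.
move=> U ab bc cd da.
have ad : edge a d by rewrite edge_sym.
have cb : edge c b by rewrite edge_sym.
have dc : edge d c by rewrite edge_sym.
have Urot : uniq [:: d; a; b; c] by rewrite -(rot_uniq 1).
have Urev : uniq [:: b; a; d; c]
  by rewrite -rev_uniq (rot_uniq 2 [:: a; b; c; d]).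
have [oab|nab] := boolP (o a b); have [oad|nad] := boolP (o a d) => //.
  by case: (no_dipath2_in_C4 Urot bc cd); rewrite ?(orientation_rev ad).
by case: (no_dipath2_in_C4 Urev dc cb); rewrite ?(orientation_rev ab).
Qed.

End AlternatingC4.

Section Prism.

Variable n : nat.

(** The boolean selects one of two copies of the cycle; the first disjunct gives the rim edges, the
    second the rungs. A length of at least 2 excludes loops. *)
Definition prism_edge : rel ('I_n.+2 * bool) := fun x y =>
  (x.2 == y.2) && ((y.1 == ordS x.1) || (x.1 == ordS y.1))
  || (x.1 == y.1) && (x.2 != y.2).

Lemma prism_edge_sym : symmetric prism_edge.
Proof.
move=> x y; rewrite /prism_edge (eq_sym x.2) (eq_sym x.1 y.1).
by rewrite [(y.1 == ordS _) || _]orbC.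
Qed.

Lemma ordS_neq (i : 'I_n.+2) : (i == ordS i) = false.
Proof.
apply/eqP => /(congr1 val) /= /eqP; have := ltn_ord i.
rewrite ltnS leq_eqVlt => /predU1P[->|lt_in]; first by rewrite modnn.
by rewrite modn_small // eqn_leq ltnn andbF.
Qed.

Lemma prism_edge_irrefl : irreflexive prism_edge.
Proof. by move=> x; rewrite /prism_edge !eqxx ordS_neq. Qed.

Definition prism : sgraph := SGraph prism_edge_sym prism_edge_irrefl.

(* [a], [b] and [k] count the forward, backward and vertical steps. *)
Lemma prism_walk_displacement (x : prism) (p : seq prism) :
  path (@edge prism) x p ->
  exists a b k, [/\ a + b + k = size p,
    x.1 + a = (last x p).1 + b %[mod n.+2] & odd k = x.2 (+) (last x p).2].
Proof.
elim: p x => [|y p IHp] x /=; first by exists 0, 0, 0; rewrite addbb.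
case/andP=> xy /IHp[a [b [k [sz mod_ab odd_k]]]].
case/orP: xy => [/andP[/eqP-> /orP[] /eqP Sxy] | /andP[/eqP-> nxy]].
- exists a.+1, b, k; split; rewrite ?addSn ?sz //.
  rewrite addnS -addSn -modnDml -[in RHS]mod_ab.
  by have /= <- := congr1 val Sxy.
- exists a, b.+1, k; split; rewrite ?addnS ?addSn ?sz //.
  have /= -> := congr1 val Sxy.
  by rewrite modnDml addSn -addn1 -modnDml mod_ab modnDml addn1.
- exists a, b, k.+1; split; rewrite ?addnS ?sz //= odd_k.
  by move: nxy; case: (x.2); case: (y.2); case: (last y p).2.
Qed.

Lemma prism_odd_cycle_size (c : seq prism) : odd_cycle c -> n.+2 <= size c.
Proof.
case: c => [|x p] [[/andP[/= cyc _] _] //= odd_p].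
have [a [b [k []]]] := prism_walk_displacement cyc.
rewrite last_rcons size_rcons addbb => sz /eqP; rewrite eqn_modDl => ab kN.
have {}odd_p : odd (a + b).
  by move: odd_p; rewrite -/(odd (size p).+1) -sz oddD kN addbF.
(* The difference [d - c] is a positive multiple of [n.+2] and at most [a + b]; this serves both
   orders of [a] and [b], which differ since their sum is odd. *)
have lt_size c d :
    c < d -> d <= a + b -> d == c %[mod n.+2] -> n.+1 < (size p).+1.
  move=> lt_cd le_d; rewrite (eqn_mod_dvd _ (ltnW lt_cd)) => /dvdn_leq.
  rewrite subn_gt0 => /(_ lt_cd) /leq_trans; apply.
  by rewrite -sz (leq_trans (leq_subr _ _)) // (leq_trans le_d) ?leq_addr.
case: (ltngtP a b) => [lt|lt|eq_ab].
- by apply: lt_size lt _ _; rewrite ?leq_addl 1?eq_sym.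
- by apply: lt_size lt _ _; rewrite ?leq_addr.
- by rewrite eq_ab addnn odd_double in odd_p.
Qed.

Lemma iter_ordS_full (i : 'I_n.+2) : iter n.+2 (@ordS n.+2) i = i.
Proof.
have val_iter k : val (iter k (@ordS n.+2) i) = (i + k) %% n.+2.
  elim: k => [|k IHk]; first by rewrite addn0 modn_small.
  by rewrite iterS /= IHk -addn1 modnDml addn1 addnS.
by apply: val_inj; rewrite val_iter modnDr modn_small.
Qed.

Lemma odd_prism_not_AOP : odd n.+2 -> ~ AOP prism.
Proof.
move=> odd_n [o [oG o_acyc o_uniq]].
pose out i := o (i, false) (i, true).
have rungF i : @edge prism (i, false) (i, true).
  by rewrite /edge /= /prism_edge eqxx.
have rungT i : @edge prism (i, true) (i, false) by rewrite edge_sym.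
have rim i s : @edge prism (i, s) (ordS i, s).
  by rewrite /edge /= /prism_edge /= !eqxx.
have rim' i s : @edge prism (ordS i, s) (i, s) by rewrite edge_sym.
(* In the square on [i] and [ordS i], each rung agrees at its [false] end with the rim edge between
   them, which is read in opposite directions from its two ends. An odd number of such flips around
   the cycle is contradictory. *)
have out_ordS i : out (ordS i) = ~~ out i.
  have -> : out (ordS i) = o (ordS i, false) (i, false).
    apply: (alternating_C4 oG o_acyc o_uniq (c := (i, true))) => //.
    by rewrite /= !inE !xpair_eqE !eqxx ?[ordS i == i]eq_sym !ordS_neq.
  have -> : out i = o (i, false) (ordS i, false).
    apply: (alternating_C4 oG o_acyc o_uniq (c := (ordS i, true))) => //.
    by rewrite /= !inE !xpair_eqE !eqxx ?[ordS i == i]eq_sym !ordS_neq.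
  exact: (orientation_rev oG).
have out_iter k : out (iter k (@ordS n.+2) ord0) = out ord0 (+) odd k.
  elim: k => [|k IHk]; first by rewrite addbF.
  by rewrite iterS out_ordS IHk /= addbN.
by have := out_iter n.+2; rewrite iter_ordS_full odd_n; case: (out ord0).
Qed.

End Prism.

Theorem theorem16 (g : nat) :
  exists G : sgraph, leq_inf g (odd_girth G) /\ ~ AOP G.
Proof.
(* The cycle length is [2g + 3], which is odd and at least [g]. *)
exists (prism g.*2.+1); split; last first.
  by apply: odd_prism_not_AOP; rewrite /= odd_double.
case girth: (odd_girth _) => [k|] //=.
have /odd_girth_Some[[c /prism_odd_cycle_size le_c <-] _] := girth.
by apply: leq_trans le_c; rewrite -addnn -!addnS leq_addr.
Qed.
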